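(* Let $G$ be a series-parallel graph with odd girth at least $5$ (i.e., $G$ has no odd cycle of length less than $5$). Then $G$ has a $C_5$-colouring if $G$ satisfies one of the following: (i) $G$ has no two $5$-cycles sharing a vertex; or (ii) $G$ has neither $8$-cycles nor $10$-cycles.
   Context: A $C_5$-colouring of $G$ is a map $\phi:V(G)\to\mathbb{Z}_5$ such that $\phi(u)-\phi(v)=\pm1$ for every edge $uv$ (a homomorphism to the 5-cycle). A 2-terminal graph $(G,s,t)$ is a graph with two distinct distinguished vertices. The serial sum $(G_1,s_1,t_1)+(G_2,s_2,t_2)$ identifies $t_1$ with $s_2$, with terminals $s_1,t_2$; the parallel sum identifies $s_1$ with $s_2$ and $t_1$ with $t_2$. A graph $G$ is series-parallel if for some terminals $s,t$, $(G,s,t)$ can be built from single edges by serial and parallel sums. *)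

(* Defs.v *)
From mathcomp Require Import all_boot all_order all_algebra.

Set Implicit Arguments.
Unset Strict Implicit.
Unset Printing Implicit Defensive.

Import GRing.Theory.

Record sgraph := SGraph {
  vertex :> finType;
  adj : rel vertex;
  adj_sym : symmetric adj;
  adj_irrefl : irreflexive adj }.

Record tgraph := TGraph {
  tbase :> sgraph;
  src : tbase;
  snk : tbase;
  src_neq_snk : src != snk }.

Definition tgraph_iso (G H : tgraph) : Prop :=
  exists f : G -> H,
    [/\ bijective f, forall x y, adj (f x) (f y) = adj x y,
        f (src G) = src H & f (snk G) = snk H].

Lemma K2_sym : symmetric (fun x y : bool => x != y).
Proof. by move=> x y; rewrite eq_sym. Qed.

Lemma K2_irrefl : irreflexive (fun x y : bool => x != y).
Proof. by move=> x; rewrite eqxx. Qed.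

Definition K2 : sgraph := SGraph K2_sym K2_irrefl.

Definition single_edge : tgraph :=
  @TGraph K2 false true isT.

(* Both sums are instances of one gluing: [i1] and [i2] map the vertices of the
   two summands to those of the sum, and an edge of the sum is the image of an
   edge of a summand. Parallel edges produced by a parallel sum are therefore
   merged; this does not enlarge the class of simple series-parallel graphs,
   since an edge joining the two terminals is always a parallel summand, so one
   of two parallel edges can be left out of the construction. *)
Section Glue.
Variables (G1 G2 : sgraph) (T : finType) (i1 : G1 -> T) (i2 : G2 -> T).

Definition glue_adj : rel T := fun u v =>
  [exists x, exists y, [&& adj x y, i1 x == u & i1 y == v]] ||
  [exists x, exists y, [&& adj x y, i2 x == u & i2 y == v]].

Lemma glue_adj_sym : symmetric glue_adj.
Proof.
suff H u v : glue_adj u v -> glue_adj v u by move=> u v; apply/idP/idP; exact: H.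
case/orP=> /existsP[x /existsP[y /and3P[xy xu yv]]]; apply/orP; [left|right];
by apply/existsP; exists y; apply/existsP; exists x; rewrite adj_sym xy xu yv.
Qed.

Lemma glue_adj_irrefl : injective i1 -> injective i2 -> irreflexive glue_adj.
Proof.
move=> inj1 inj2 u; apply/negP.
case/orP=> /existsP[x /existsP[y /and3P[xy /eqP xu /eqP yu]]].
  by move: xy; rewrite (inj1 x y) ?adj_irrefl // xu.
by move: xy; rewrite (inj2 x y) ?adj_irrefl // xu.
Qed.

Definition glue (inj1 : injective i1) (inj2 : injective i2) : sgraph :=
  SGraph glue_adj_sym (glue_adj_irrefl inj1 inj2).

End Glue.

Lemma inl_injective (A B : Type) : injective (@inl A B).
Proof. by move=> x y []. Qed.

Section Serial.
Variables G1 G2 : tgraph.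

(* The vertices of the second summand other than its source; the source is
   represented by the sink of the first summand. *)
Definition serial_vertex : finType := (G1 + {x : G2 | x != src G2})%type.

Definition serial_inr (x : G2) : serial_vertex :=
  if insub x is Some y then inr y else inl (snk G1).

Lemma serial_inr_inj : injective serial_inr.
Proof.
move=> x y; rewrite /serial_inr.
case: insubP => [u _ <-|/negbNE/eqP->]; case: insubP => [v _ <-|/negbNE/eqP->] //.
by case=> ->.
Qed.

Lemma serial_neq : inl (src G1) != serial_inr (snk G2) :> serial_vertex.
Proof. by rewrite /serial_inr insubT 1?eq_sym ?src_neq_snk. Qed.

Definition serial_sum : tgraph :=
  @TGraph (glue (@inl_injective _ _) serial_inr_inj) _ _ serial_neq.

End Serial.

Section Parallel.
Variables G1 G2 : tgraph.

(* The vertices of the second summand other than its terminals, which are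
   represented by the terminals of the first summand. *)
Definition parallel_vertex : finType :=
  (G1 + {x : G2 | (x != src G2) && (x != snk G2)})%type.

Definition parallel_inr (x : G2) : parallel_vertex :=
  if insub x is Some y then inr y
  else inl (if x == src G2 then src G1 else snk G1).

Lemma parallel_inr_inj : injective parallel_inr.
Proof.
have st := negbTE (src_neq_snk G1).
have D (z : G2) : ~~ ((z != src G2) && (z != snk G2)) -> z = src G2 \/ z = snk G2.
  by rewrite negb_and !negbK => /orP[]/eqP; [left|right].
move=> x y; rewrite /parallel_inr.
case: insubP => [u _ <-|/D Dx]; case: insubP => [v _ <-|/D Dy] //.
  by case=> ->.
have ts : (snk G2 == src G2) = false by rewrite eq_sym; apply/negbTE/src_neq_snk.
case: Dx Dy => -> [] ->; rewrite ?eqxx ?ts // => -[] /eqP; first by rewrite st.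
by rewrite eq_sym st.
Qed.

Lemma parallel_neq : inl (src G1) != inl (snk G1) :> parallel_vertex.
Proof. exact: src_neq_snk. Qed.

Definition parallel_sum : tgraph :=
  @TGraph (glue (@inl_injective _ _) parallel_inr_inj) _ _ parallel_neq.

End Parallel.

Inductive sp_built : tgraph -> Prop :=
| Sp_edge : sp_built single_edge
| Sp_serial G1 G2 :
    sp_built G1 -> sp_built G2 -> sp_built (serial_sum G1 G2)
| Sp_parallel G1 G2 :
    sp_built G1 -> sp_built G2 -> sp_built (parallel_sum G1 G2)
| Sp_iso G H : sp_built G -> tgraph_iso G H -> sp_built H.

Definition series_parallel (G : sgraph) : Prop :=
  exists (s t : G) (st : s != t), sp_built (TGraph st).

(* A cycle is traversed by a sequence of distinct vertices; the closing edge
   goes from the last vertex back to the first. *)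
Definition is_cycle (G : sgraph) (k : nat) (c : seq G) : Prop :=
  [/\ size c = k, 2 < k & ucycle (@adj G) c].

(* The edge set is what identifies a cycle as a subgraph: the same cycle is
   traversed by several sequences. *)
Definition cycle_edges (G : sgraph) (c : seq G) : {set {set G}} :=
  [set [set x; next c x] | x in c].

Definition odd_girth_geq (G : sgraph) (g : nat) : Prop :=
  forall (k : nat) (c : seq G), is_cycle k c -> odd k -> g <= k.

Definition has_cycle (G : sgraph) (k : nat) : Prop :=
  exists c : seq G, is_cycle k c.

Definition two_cycles_sharing_vertex (G : sgraph) (k : nat) : Prop :=
  exists c1 c2 : seq G,
    [/\ is_cycle k c1, is_cycle k c2, cycle_edges c1 <> cycle_edges c2
      & exists x : G, x \in c1 /\ x \in c2].

Definition C5_colouring (G : sgraph) (phi : G -> 'Z_5) : Prop :=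
  forall u v : G, adj u v -> (phi u - phi v = 1 \/ phi u - phi v = - 1)%R.

(* Main.v *)
Require Import Defs.
From mathcomp Require Import all_boot all_order all_algebra ring.

(** The differences [phi t - phi s] realized by the C5-colourings of a
    two-terminal graph form a subset of Z_5 that is the sumset of the two parts
    for a serial sum and their intersection for a parallel sum. Each
    series-parallel graph is shown to have one of finitely many types, a type
    being a list of lengths of s-t paths together with a list of realized
    differences. Among the five types needed under (i), the only harmful serial
    sum is that of two graphs with paths of lengths 2 and 3, which are only known
    to realize 2 and -2: it contains two 5-cycles sharing a vertex, so it is
    excluded. Under (ii) it leads to two further types; whenever the differences
    of a parallel sum fit none of the types, the path lengths force a cycle of
    length 3, 8 or 10. *)

Set Implicit Arguments.
Unset Strict Implicit.
Unset Printing Implicit Defensive.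

Import GRing.Theory.

(** * Cycles under injective homomorphisms *)

Section Embedding.
Variables (G H : sgraph) (f : G -> H).
Hypothesis (f_inj : injective f) (f_adj : forall x y, adj x y -> adj (f x) (f y)).

Lemma path_map_embedding x p :
  path (@adj G) x p -> path (@adj H) (f x) (map f p).
Proof. by elim: p x => //= y p IH x /andP[/f_adj-> /IH]. Qed.

Lemma is_cycle_map k c : is_cycle k c -> is_cycle k (map f c).
Proof.
case=> sz k2 /andP[cyc un]; split; rewrite ?size_map //.
apply/andP; split; last by rewrite map_inj_uniq.
by case: c cyc {sz un} => //= x p /path_map_embedding; rewrite map_rcons.
Qed.

Lemma has_cycle_embedding k : has_cycle G k -> has_cycle H k.
Proof. by case=> c /is_cycle_map; exists (map f c). Qed.

End Embedding.

(** Closure under subgraphs, induced or not: a condition imposed on a sum then descends to both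
    summands in the induction. *)
Definition hereditary (good : sgraph -> Prop) : Prop :=
  forall (G H : sgraph) (f : G -> H), injective f ->
  (forall x y, adj x y -> adj (f x) (f y)) -> good H -> good G.

(** * Terminal paths and realized differences *)

Definition terminal_path (G : tgraph) (p : seq G) : Prop :=
  [/\ path (@adj G) (src G) p, last (src G) p = snk G & uniq (src G :: p)].

Definition has_path_length (G : tgraph) (n : nat) : Prop :=
  exists2 p : seq G, terminal_path p & size p = n.

Definition realizes (G : tgraph) (d : 'Z_5) : Prop :=
  exists2 phi : G -> 'Z_5, C5_colouring phi & (phi (snk G) - phi (src G) = d)%R.

Lemma has_path_length_embedding (G H : tgraph) (f : G -> H) n :
  injective f -> (forall x y, adj x y -> adj (f x) (f y)) ->
  f (src G) = src H -> f (snk G) = snk H ->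
  has_path_length G n -> has_path_length H n.
Proof.
move=> f_inj f_adj fs ft [p [pth lst un] sz]; exists (map f p); last by rewrite size_map.
split; rewrite -fs; first exact: path_map_embedding.
- by rewrite last_map lst.
- by rewrite -map_cons map_inj_uniq.
Qed.

Lemma C5_colouring_shift (G : sgraph) (phi : G -> 'Z_5) a :
  C5_colouring phi -> C5_colouring (fun x => phi x + a)%R.
Proof.
move=> col u v /col; suff -> : (phi u + a - (phi v + a) = phi u - phi v)%R by [].
by rewrite opprD addrACA subrr addr0.
Qed.

(** * Edges and colourings of a gluing *)

Section GlueTheory.
Variables (G1 G2 : sgraph) (T : finType) (i1 : G1 -> T) (i2 : G2 -> T).
Hypothesis (inj1 : injective i1) (inj2 : injective i2).
Let G := glue inj1 inj2.

Lemma glue_adjl x y : adj x y -> @adj G (i1 x) (i1 y).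
Proof.
by move=> xy; apply/orP; left; apply/existsP; exists x; apply/existsP; exists y;
   rewrite xy !eqxx.
Qed.

Lemma glue_adjr x y : adj x y -> @adj G (i2 x) (i2 y).
Proof.
by move=> xy; apply/orP; right; apply/existsP; exists x; apply/existsP; exists y;
   rewrite xy !eqxx.
Qed.

Lemma glue_colouring (phi : G -> 'Z_5) (phi1 : G1 -> 'Z_5) (phi2 : G2 -> 'Z_5) :
  phi \o i1 =1 phi1 -> phi \o i2 =1 phi2 ->
  C5_colouring phi1 -> C5_colouring phi2 -> C5_colouring phi.
Proof.
move=> e1 e2 c1 c2 u v.
case/orP=> /existsP[x /existsP[y /and3P[xy /eqP<- /eqP<-]]].
- by have := c1 _ _ xy; rewrite -!e1.
- by have := c2 _ _ xy; rewrite -!e2.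
Qed.

End GlueTheory.

(** * Serial sums: lengths and differences add *)

Section SerialTheory.
Variables G1 G2 : tgraph.
Let G := serial_sum G1 G2.
Let il : G1 -> G := inl.
Let ir : G2 -> G := @serial_inr G1 G2.

Lemma serial_adjl x y : adj x y -> adj (il x) (il y).
Proof. exact: glue_adjl. Qed.

Lemma serial_adjr x y : adj x y -> adj (ir x) (ir y).
Proof. exact: glue_adjr. Qed.

Lemma serial_inr_src : ir (src G2) = il (snk G1).
Proof. by rewrite /ir /serial_inr insubF // eqxx. Qed.

Lemma serial_inl_eq_inr x y : il x = ir y -> x = snk G1 /\ y = src G2.
Proof.
rewrite /il /ir /serial_inr; case: insubP => // /negbNE/eqP-> [->].
by split.
Qed.

Lemma serial_path_length n1 n2 :
  has_path_length G1 n1 -> has_path_length G2 n2 -> has_path_length G (n1 + n2).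
Proof.
case=> p1 [pth1 lst1 un1] <- [p2 [pth2 lst2 un2] <-].
exists (map il p1 ++ map ir p2); last by rewrite size_cat !size_map.
have lastl : last (src G) (map il p1) = ir (src G2).
  by rewrite (last_map il) lst1 serial_inr_src.
split; first 2 last.
- rewrite -cat_cons -(map_cons il) cat_uniq (map_inj_uniq (@inl_injective _ _)) un1.
  move: un2; rewrite cons_uniq => /andP[s2 un2].
  rewrite (map_inj_uniq (@serial_inr_inj _ _)) un2 andbT andTb.
  (* A common vertex could only be the glued one, which is the source of [G2]; by uniqueness it does
     not recur in [p2]. *)
  apply/hasPn=> _ /mapP[y yp ->]; apply/mapP=> -[x _ /esym/serial_inl_eq_inr[_ ys]].
  by rewrite -ys yp in s2.
- rewrite cat_path lastl (path_map_embedding serial_adjr pth2) andbT.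
  exact: (path_map_embedding serial_adjl pth1).
- by rewrite last_cat lastl (last_map ir) lst2.
Qed.

Lemma serial_realizes d1 d2 :
  realizes G1 d1 -> realizes G2 d2 -> realizes G (d1 + d2)%R.
Proof.
case=> phi1 c1 <- [phi2 c2 <-].
(* Shifting [phi2] by [a] makes the two colourings agree at the glued vertex and keeps
   differences. *)
pose a := (phi1 (snk G1) - phi2 (src G2))%R.
pose phi (u : G) : 'Z_5 :=
  match u with inl x => phi1 x | inr y => phi2 (val y) + a end%R.
have e2 : phi \o ir =1 (fun y => phi2 y + a)%R.
  move=> y; rewrite /= /ir /serial_inr; case: insubP => [z _ <-|/negbNE/eqP->] //=.
  by rewrite /a addrC subrK.
exists phi; first exact: (glue_colouring (fun _ => erefl) e2 c1 (C5_colouring_shift a c2)).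
have /= -> := e2 (snk G2); rewrite /a; ring.
Qed.

Lemma hereditary_seriall good : hereditary good -> good G -> good G1.
Proof. by move=> H; apply: (H _ _ il); [exact: inl_injective | exact: serial_adjl]. Qed.

Lemma hereditary_serialr good : hereditary good -> good G -> good G2.
Proof. by move=> H; apply: (H _ _ ir); [exact: serial_inr_inj | exact: serial_adjr]. Qed.

End SerialTheory.

(** * Parallel sums: differences intersect, paths close up to cycles *)

Section ParallelTheory.
Variables G1 G2 : tgraph.
Let G := parallel_sum G1 G2.
Let il : G1 -> G := inl.
Let ir : G2 -> G := @parallel_inr G1 G2.

Lemma parallel_adjl x y : adj x y -> adj (il x) (il y).
Proof. exact: glue_adjl. Qed.

Lemma parallel_adjr x y : adj x y -> adj (ir x) (ir y).
Proof. exact: glue_adjr. Qed.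

Lemma parallel_inr_src : ir (src G2) = src G.
Proof. by rewrite /ir /parallel_inr insubF ?eqxx. Qed.

Lemma parallel_inr_snk : ir (snk G2) = snk G.
Proof.
by rewrite /ir /parallel_inr insubF ?eqxx ?andbF // eq_sym (negbTE (src_neq_snk G2)).
Qed.

Lemma parallel_inl_eq_inr x y : il x = ir y -> y = src G2 \/ y = snk G2.
Proof.
rewrite /il /ir /parallel_inr; case: insubP => // + _.
by rewrite negb_and !negbK => /orP[]/eqP; [left|right].
Qed.

Lemma parallel_path_lengthl n : has_path_length G1 n -> has_path_length G n.
Proof.
exact: (has_path_length_embedding (f := il) (@inl_injective _ _) parallel_adjl).
Qed.

Lemma parallel_path_lengthr n : has_path_length G2 n -> has_path_length G n.
Proof.
exact: (has_path_length_embedding (f := ir) (@parallel_inr_inj G1 G2) parallel_adjr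
  parallel_inr_src parallel_inr_snk).
Qed.

Lemma parallel_realizes d : realizes G1 d -> realizes G2 d -> realizes G d.
Proof.
case=> phi1 c1 e1 [phi2 c2 e2].
(* The shift matches the sources; the sinks then match because both colourings have the same
   difference [d]. *)
pose a := (phi1 (src G1) - phi2 (src G2))%R.
pose phi (u : G) : 'Z_5 :=
  match u with inl x => phi1 x | inr y => phi2 (val y) + a end%R.
have ephi : phi \o ir =1 (fun y => phi2 y + a)%R.
  move=> y; rewrite /= /ir /parallel_inr; case: insubP => [z _ <-|] //=.
  rewrite negb_and !negbK => /orP[]/eqP->; first by rewrite eqxx /a addrC subrK.
  rewrite eq_sym (negbTE (src_neq_snk G2)) /a.
  have -> : phi1 (snk G1) = (d + phi1 (src G1))%R by rewrite -e1 subrK.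
  by rewrite -e2; ring.
exists phi; last exact: e1.
exact: (glue_colouring (fun _ => erefl) ephi c1 (C5_colouring_shift a c2)).
Qed.

(** Go along the first path and return along the second. The bound excludes the case of two single
    edges, which the gluing merges. *)
Lemma parallel_cycle n1 n2 :
  has_path_length G1 n1 -> has_path_length G2 n2 -> 2 < n1 + n2 ->
  has_cycle G (n1 + n2).
Proof.
case=> p1 [pth1 lst1 un1] <- [p2 [pth2 lst2 un2] <-] gt2.
(* The second path is split as [rcons q2 z] with [z] its sink, so that [q2] holds exactly its inner
   vertices. *)
case/lastP: p2 pth2 lst2 un2 gt2 => [_ /eqP|q2 z].
  by rewrite (negbTE (src_neq_snk G2)).
rewrite last_rcons size_rcons addnS => pth2 zE; subst z => un2 gt2.
exists (src G :: map il p1 ++ map ir (rev q2)).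
split=> //; first by rewrite /= size_cat !size_map size_rev.
have lastl : last (src G) (map il p1) = ir (snk G2).
  by rewrite (last_map il) lst1 parallel_inr_snk.
apply/andP; split.
  rewrite /cycle rcons_cat cat_path (path_map_embedding parallel_adjl pth1) andTb.
  rewrite lastl -[X in rcons _ X]parallel_inr_src -map_rcons.
  apply: (path_map_embedding parallel_adjr).
  (* Reversal yields a path for the flipped relation, which equals [adj] by symmetry. *)
  have := rev_path (@adj G2) (src G2) (rcons q2 (snk G2)).
  rewrite last_rcons belast_rcons rev_cons => ->.
  by rewrite (eq_path (e' := @adj G2)) // => x y; rewrite adj_sym.
rewrite -cat_cons -(map_cons il) cat_uniq (map_inj_uniq (@inl_injective _ _)) un1 andTb.
move: un2; rewrite cons_uniq mem_rcons rcons_uniq inE negb_or.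
case/and3P=> /andP[_ sq] tq uq.
rewrite (map_inj_uniq (@parallel_inr_inj _ _)) rev_uniq uq andbT.
apply/hasPn=> _ /mapP[y yq ->]; apply/mapP=> -[x _ /esym/parallel_inl_eq_inr ey].
rewrite mem_rev in yq.
by case: ey yq => ->; apply/negP.
Qed.

Lemma hereditary_parallell good : hereditary good -> good G -> good G1.
Proof. by move=> H; apply: (H _ _ il); [exact: inl_injective | exact: parallel_adjl]. Qed.

Lemma hereditary_parallelr good : hereditary good -> good G -> good G2.
Proof. by move=> H; apply: (H _ _ ir); [exact: parallel_inr_inj | exact: parallel_adjr]. Qed.

End ParallelTheory.

(** * Types and their composition *)

Definition sp_type : Type := (seq nat * seq 'Z_5)%type.

(** Both lists are lower bounds only: a graph may have further path lengths and differences. This is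
    what lets finitely many types suffice. *)
Definition has_type (G : tgraph) (t : sp_type) : Prop :=
  (forall n, n \in t.1 -> has_path_length G n) /\
  (forall d, d \in t.2 -> realizes G d).

Definition serial_fits (t1 t2 t : sp_type) : bool :=
  all (mem [seq a + b | a <- t1.1, b <- t2.1]) t.1 &&
  all (mem [seq a + b | a <- t1.2, b <- t2.2]%R) t.2.

Definition parallel_fits (t1 t2 t : sp_type) : bool :=
  all (mem (t1.1 ++ t2.1)) t.1 &&
  all (fun d => (d \in t1.2) && (d \in t2.2)) t.2.

Lemma serial_has_type (G1 G2 : tgraph) t1 t2 t :
  has_type G1 t1 -> has_type G2 t2 -> serial_fits t1 t2 t ->
  has_type (serial_sum G1 G2) t.
Proof.
move=> [l1 r1] [l2 r2] /andP[/allP fl /allP fr]; split.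
- by move=> n /fl/allpairsP[[a b] /= [/l1 ? /l2 ? ->]]; apply: serial_path_length.
- by move=> d /fr/allpairsP[[a b] /= [/r1 ? /r2 ? ->]]; apply: serial_realizes.
Qed.

Lemma parallel_has_type (G1 G2 : tgraph) t1 t2 t :
  has_type G1 t1 -> has_type G2 t2 -> parallel_fits t1 t2 t ->
  has_type (parallel_sum G1 G2) t.
Proof.
move=> [l1 r1] [l2 r2] /andP[/allP fl /allP fr]; split.
- move=> n /fl; rewrite inE mem_cat => /orP[/l1|/l2].
  + exact: parallel_path_lengthl.
  + exact: parallel_path_lengthr.
- by move=> d /fr/andP[/r1 ? /r2 ?]; apply: parallel_realizes.
Qed.

Lemma has_type_iso (G H : tgraph) t : tgraph_iso G H -> has_type G t -> has_type H t.
Proof.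
case=> f [[g fK gK] fadj fs ft] [l r]; split=> [n /l|d /r[phi c <-]].
  by apply: has_path_length_embedding fs ft; [exact: can_inj fK | move=> x y; rewrite fadj].
exists (phi \o g); last by rewrite -fs -ft /= !fK.
by move=> u v uv; apply: c; rewrite -fadj !gK.
Qed.

Definition edge_type : sp_type := ([:: 1], [:: 1; 4]%R).

Lemma single_edge_has_type : has_type single_edge edge_type.
Proof.
split=> [n|d]; rewrite !inE; first by move/eqP->; exists [:: true].
case/orP=> /eqP->.
- exists (fun b : bool => b%:R : 'Z_5)%R; last by apply/eqP.
  by move=> [] [] //= _; [left | right]; apply/eqP.
(* Source 1 and sink 0 give the difference -1, which is 4 in ['Z_5]. *)
- exists (fun b : bool => (~~ b)%:R : 'Z_5)%R; last by apply/eqP.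
  by move=> [] [] //= _; [right | left]; apply/eqP.
Qed.

(** [ks] lists forbidden cycle lengths: a pair of types is harmless if two of its path lengths add
    up to one of them, since the parallel sum then cannot occur. *)
Definition parallel_closed (ks : seq nat) (ts : seq sp_type) : bool :=
  all (fun t1 => all (fun t2 =>
    has (mem ks) [seq a + b | a <- t1.1, b <- t2.1] || has (parallel_fits t1 t2) ts)
    ts) ts.

(** [excl] marks types no two of which may occur in series; such pairs require no resulting type. *)
Definition serial_closed (excl : sp_type -> bool) (ts : seq sp_type) : bool :=
  all (fun t1 => all (fun t2 =>
    (excl t1 && excl t2) || has (serial_fits t1 t2) ts) ts) ts.

(** * Classification by induction on the construction *)

Section Classification.
Variables (good : sgraph -> Prop) (ks : seq nat) (excl : sp_type -> bool).
Variable ts : seq sp_type.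
Hypothesis (good_hered : hereditary good).
Hypothesis (ks_gt2 : all (leq 3) ks).
Hypothesis (good_cycle : forall G k, good G -> k \in ks -> ~ has_cycle G k).
Hypothesis (good_excl : forall G1 G2 t1 t2, has_type G1 t1 -> has_type G2 t2 ->
  excl t1 -> excl t2 -> ~ good (serial_sum G1 G2)).
Hypothesis (edge_ts : edge_type \in ts).
Hypothesis (ts_parallel : parallel_closed ks ts) (ts_serial : serial_closed excl ts).

Lemma sp_built_has_type (G : tgraph) :
  sp_built G -> good G -> exists2 t, t \in ts & has_type G t.
Proof.
elim=> {G} [_|G1 G2 _ IH1 _ IH2 gG|G1 G2 _ IH1 _ IH2 gG|G H _ IH iso gH].
- by exists edge_type => //; exact: single_edge_has_type.
- have [t1 t1ts h1] := IH1 (hereditary_seriall good_hered gG).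
  have [t2 t2ts h2] := IH2 (hereditary_serialr good_hered gG).
  have /orP[/andP[x1 x2]|/hasP[t tts fits]] := allP (allP ts_serial _ t1ts) _ t2ts.
    by case: (good_excl h1 h2 x1 x2 gG).
  by exists t => //; exact: serial_has_type fits.
- have [t1 t1ts h1] := IH1 (hereditary_parallell good_hered gG).
  have [t2 t2ts h2] := IH2 (hereditary_parallelr good_hered gG).
  have /orP[/hasP[k /allpairsP[[a b] /= [a1 b2 ->]] kks]|/hasP[t tts fits]] :=
    allP (allP ts_parallel _ t1ts) _ t2ts.
    case: (good_cycle gG kks); apply: parallel_cycle (allP ks_gt2 _ kks).
    + exact: h1.1.
    + exact: h2.1.
  by exists t => //; exact: parallel_has_type fits.
- case: (iso) => f [[g fK _] fadj _ _].
  have [|t tts ht] := IH; last by exists t => //; exact: has_type_iso ht.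
  by apply: (good_hered (can_inj fK) _ gH) => x y; rewrite fadj.
Qed.

(** Each realized difference is witnessed by a colouring, so one listed difference per type is
    enough. *)
Lemma good_colourable (G : sgraph) :
  all (fun t => t.2 != [::]) ts -> series_parallel G -> good G ->
  exists phi : G -> 'Z_5, C5_colouring phi.
Proof.
move=> /allP ne [s [t [st /sp_built_has_type built]]] /built[[l [|d ds]] /ne //= _ [_ r]].
by have [|phi] := r d; [exact: mem_head | exists phi].
Qed.

End Classification.

(** * Condition (i): pentagons without common vertices *)

Lemma pentagon_of_paths (G : tgraph) :
  ~ has_cycle G 3 -> has_path_length G 2 -> has_path_length G 3 ->
  exists c : seq G, [/\ is_cycle 5 c, src G \in c & snk G \in c].
Proof.
move=> no3 [[|a [|t []]] //= [] /=]; rewrite andbT => /andP[sa at_] tE; subst t.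
move=> un1 _ [[|b [|c [|t []]]] //= [] /=]; rewrite andbT.
move=> /and3P[sb bc ct] tE; subst t => un2 _.
(* If the two paths shared an inner vertex, a triangle would arise; hence they bound a pentagon
   through both terminals. *)
have ab : a != b.
  apply/eqP=> eab; subst b; case: no3; exists [:: a; c; snk G].
  split=> //; rewrite /ucycle /= bc ct adj_sym at_ /=.
  by case/andP: un2.
have ac : a != c.
  apply/eqP=> eac; subst c; case: no3; exists [:: src G; b; a].
  split=> //; rewrite /ucycle /= sb bc adj_sym sa /=.
  by move: un2; rewrite /= !inE !negb_or => /and4P[/and3P[-> -> _] /andP[-> _] _ _].
exists [:: src G; a; snk G; c; b]; split; rewrite ?inE ?eqxx ?orbT //.
split=> //; rewrite /ucycle /= sa at_ (adj_sym _ c) ct (adj_sym c) bc (adj_sym b) sb /=.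
move: un1 un2; rewrite /= !inE !negb_or.
move=> /and3P[/andP[-> ->] -> _] /and4P[/and3P[-> -> _] /andP[bc' bt] ct' _].
by rewrite ac ab (eq_sym (snk G)) ct' (eq_sym (snk G)) bt (eq_sym c) bc'.
Qed.

(* Vertex sets replace edge sets because their inclusion is visibly preserved
   and reflected by embeddings. *)
Definition isolated_pentagons (G : sgraph) : Prop :=
  ~ has_cycle G 3 /\
  (forall (c1 c2 : seq G) x, is_cycle 5 c1 -> is_cycle 5 c2 ->
    x \in c1 -> x \in c2 -> {subset c1 <= c2}).

Lemma isolated_pentagons_hereditary : hereditary isolated_pentagons.
Proof.
move=> G H f f_inj f_adj [no3 share]; split.
  by move=> c; apply: no3; exact: has_cycle_embedding f_inj f_adj _ c.
move=> c1 c2 x cyc1 cyc2 x1 x2 y y1.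
rewrite -(mem_map f_inj).
apply: (share (map f c1) (map f c2) (f x)); rewrite ?mem_map //; exact: is_cycle_map.
Qed.

Lemma cycle_edges_subset (G : sgraph) (c1 c2 : seq G) :
  cycle_edges c1 = cycle_edges c2 -> {subset c1 <= c2}.
Proof.
move=> e x x1.
have : [set x; next c1 x] \in cycle_edges c2.
  by rewrite -e; apply/imsetP; exists x.
case/imsetP=> y y2 exy; have : x \in [set y; next c2 y] by rewrite -exy set21.
by case/set2P=> ->; rewrite ?mem_next.
Qed.

Lemma isolated_pentagons_of_no_sharing (G : sgraph) :
  ~ has_cycle G 3 -> ~ two_cycles_sharing_vertex G 5 -> isolated_pentagons G.
Proof.
move=> no3 share; split=> // c1 c2 x cyc1 cyc2 x1 x2.
apply: cycle_edges_subset; apply/eqP/negPn/negP=> /eqP ne.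
by apply: share; exists c1, c2; split=> //; exists x.
Qed.

Definition pentagon_type (t : sp_type) : bool := (2 \in t.1) && (3 \in t.1).

(** Each summand has a pentagon through the glued vertex. Isolation would put the source of [G1]
    into the image of [G2], which meets [G1] only in its sink. *)
Lemma isolated_pentagons_serial (G1 G2 : tgraph) t1 t2 :
  has_type G1 t1 -> has_type G2 t2 -> pentagon_type t1 -> pentagon_type t2 ->
  ~ isolated_pentagons (serial_sum G1 G2).
Proof.
move=> [l1 _] [l2 _] /andP[/l1 p2 /l1 p3] /andP[/l2 q2 /l2 q3] iso.
have [no3l _] := hereditary_seriall isolated_pentagons_hereditary iso.
have [no3r _] := hereditary_serialr isolated_pentagons_hereditary iso.
have [c1 [cyc1 s1 k1]] := pentagon_of_paths no3l p2 p3.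
have [c2 [cyc2 s2 _]] := pentagon_of_paths no3r q2 q3.
have k2 : inl (snk G1) \in map (@serial_inr G1 G2) c2.
  by rewrite -serial_inr_src map_f.
have cyc1' := is_cycle_map (H := serial_sum G1 G2) (@inl_injective _ _)
  (@serial_adjl G1 G2) cyc1.
have cyc2' := is_cycle_map (H := serial_sum G1 G2) (@serial_inr_inj G1 G2)
  (@serial_adjr G1 G2) cyc2.
have := iso.2 _ _ _ cyc1' cyc2' (map_f _ k1) k2 _ (map_f _ s1).
case/mapP=> x _ /serial_inl_eq_inr[e _].
by have := src_neq_snk G1; rewrite e eqxx.
Qed.

(** * Condition (ii) and the tables of types *)

Definition no_cycle_3_8_10 (G : sgraph) : Prop :=
  forall k, k \in [:: 3; 8; 10] -> ~ has_cycle G k.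

Lemma no_cycle_3_8_10_hereditary : hereditary no_cycle_3_8_10.
Proof.
move=> G H f f_inj f_adj no k /no{}no c; apply: no.
exact: has_cycle_embedding f_inj f_adj _ c.
Qed.

(** The first four rows are modelled on an edge, paths of two and three edges, and the parallel sum
    of these two paths, a pentagon. The last row promises no path but all differences, so it
    restricts nothing in a parallel sum; it absorbs, for example, two graphs of the second type in
    series. *)
Definition types_i : seq sp_type :=
  [:: edge_type;
      ([:: 2], [:: 0; 2; 3]%R);
      ([:: 3], [:: 1; 2; 3; 4]%R);
      ([:: 2; 3], [:: 2; 3]%R);
      ([::], [:: 0; 1; 2; 3; 4]%R)].

(* The last two types are those of two and of three pentagons in series. *)
Definition types_ii : seq sp_type :=
  types_i ++ [:: ([:: 4; 5; 6], [:: 0; 1; 4]%R); ([:: 6], [:: 1; 2; 3; 4]%R)].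

Theorem theorem3p4 (G : sgraph)
    (hSP : series_parallel G)
    (hgirth : odd_girth_geq G 5)
    (hcyc : ~ two_cycles_sharing_vertex G 5 \/
            (~ has_cycle G 8 /\ ~ has_cycle G 10)) :
  exists phi : G -> 'Z_5, C5_colouring phi.
Proof.
have no3 : ~ has_cycle G 3 by case=> c /hgirth/(_ isT).
case: hcyc => [share|[no8 no10]].
  (* The closure of the table under both sums is a finite check, done by computation. *)
  apply: (good_colourable (ks := [:: 3]) (ts := types_i) isolated_pentagons_hereditary
    _ _ isolated_pentagons_serial) => //; try by vm_compute.
  - by move=> H k [no _]; rewrite inE => /eqP->.
  - exact: isolated_pentagons_of_no_sharing.
(* No serial sum is excluded here. Differences 0, 1, 4 against the types of lengths 2, 3 and both
   fit no type, but 6 + 2 = 5 + 3 = 8; against the type of length 6 they leave 1, 4, and 4 + 6 = 10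
   is forbidden. *)
apply: (good_colourable (ks := [:: 3; 8; 10]) (excl := fun=> false) (ts := types_ii)
  no_cycle_3_8_10_hereditary) => //; try by vm_compute.
- by move=> H k no /no.
- by move=> k; rewrite !inE => /or3P[]/eqP->.
Qed.
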